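(* Let $\mathfrak{s}=(\mathrm{Aff},\mathcal{T})$ be the site of open subsets of Euclidean spaces and smooth maps with the Euclidean topology, and let $X$ be an object of $\mathrm{Aff}$, i.e. an open subset of some $\mathbb{R}^n$. Then $X$, with its Euclidean subspace topology, is canonically homeomorphic to its underlying topological space $\underline{X}=\Lambda_X^{\mathrm{top}}$, the Stone dual of the locale $\Lambda_X$ of open subschemes of $X$. Under this homeomorphism, the point $x\in X$ corresponds to the element $f\in\Lambda_X^{\mathrm{top}}$ for which $\{u\in\Lambda_X\mid f^\ast(u)=\mathbf{0}\}$ is the principal prime ideal generated by $[X\setminus\{x\}\to X]$, and for an open subset $U\subset X$ with class $u=[U\to X]$, the open subset $\{f\mid f^\ast(u)=\mathbf{1}\}$ of $\underline{X}$ corresponds to $U$.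
   Context: The category $\mathrm{Aff}$ has as objects the open subsets of Euclidean spaces $\mathbb{R}^n$ and as morphisms the smooth maps. The Euclidean topology $\mathcal{T}$ is the Grothendieck pretopology whose covering families are the jointly surjective families $\{\iota_i:U_i\to X\}$ of smooth open embeddings (diffeomorphisms onto open subsets). $\mathrm{Sh}_{\mathfrak{s}}$ is the category of sheaves of sets on $\mathfrak{s}$; objects $X$ of $\mathrm{Aff}$ are identified with the sheaves $\mathrm{Hom}(-,X)$. A principal open is a morphism that appears in a covering family of $\mathcal{T}$, i.e. a smooth open embedding. For a family $\mathcal{S}=\{U_i\to X\}$ of principal opens (not necessarily jointly surjective), the atlas $\mathcal{U}_{\mathcal{S}}$ is the diagram consisting of all $U_i$ and all pairwise fibre products $U_{ij}=U_i\times_XU_j$ together with the canonical projections $U_{ij}\to U_i$ and $U_{ij}\to U_j$. An open immersion into $X$ is a sheaf of the form $U=\mathrm{colim}_{\mathrm{Sh}_{\mathfrak{s}}}\,\mathcal{U}_{\mathcal{S}}$ for such a family, together with the canonical inclusion $U\to X$. Two open immersions $U\to X$ and $V\to X$ are isomorphic if there is an isomorphism $U\simeq V$ commuting with the morphisms to $X$. An open subscheme of $X$ is an isomorphism class $[U\to X]$ of open immersions. $\Lambda_X$ is the set of open subschemes of $X$, ordered by $[V\to X]\leq[U\to X]$ if and only if there is a morphism $V\to U$ commuting with the morphisms to $X$; it is a locale. A locale is a complete lattice in which finite meets distribute over arbitrary joins; a morphism $f:\Lambda\to\Lambda'$ of locales is a map $f^\ast:\Lambda'\to\Lambda$ preserving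 bottom $\mathbf{0}$, top $\mathbf{1}$, arbitrary joins and finite meets. Let $\mathbb{1}^{\mathrm{loc}}=\{\mathbf{0},\mathbf{1}\}$ be the two-element locale. The Stone dual $\Lambda^{\mathrm{top}}$ of a locale $\Lambda$ is the set of morphisms of locales $f:\mathbb{1}^{\mathrm{loc}}\to\Lambda$ (i.e. maps $f^\ast:\Lambda\to\{\mathbf{0},\mathbf{1}\}$ preserving bottom $\mathbf{0}$, top $\mathbf{1}$, arbitrary joins and finite meets) with open subsets $\{f\mid f^\ast(u)=\mathbf{1}\}$ for $u\in\Lambda$. The principal ideal generated by $u$ is $\{v\in\Lambda\mid v\leq u\}$; it is prime if its complement is non-empty and closed under finite meets. *)

(* Defs.v *)
From HB Require Import structures.
From mathcomp Require Import all_boot all_order all_algebra.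
From mathcomp Require Import all_classical all_reals all_analysis.
Import Order.TTheory GRing.Theory Num.Theory.
Import numFieldNormedType.Exports.
Set Implicit Arguments.
Unset Strict Implicit.
Unset Printing Implicit Defensive.
Local Open Scope classical_set_scope.
Local Open Scope ring_scope.

(* C^oo at every point of A: f and all its iterated directional derivatives
   are Frechet differentiable there. *)
Definition smooth_on (R : realType) (V W : normedModType R)
    (A : set V) (f : V -> W) : Prop :=
  forall (s : seq V) (x : V), A x ->
    differentiable (foldl (fun g v => 'D_v g) f s) x.

Fixpoint diff_upto (R : realType) (V W : normedModType R) (k : nat)
    (A : set V) (f : V -> W) : Prop :=
  (forall x, A x -> differentiable f x) /\
  (if k is k'.+1 then forall v, diff_upto k' A ('D_v f) else True).

Lemma diff_uptoS (R : realType) (V W : normedModType R) k (A : set V) (f : V -> W) :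
  diff_upto k.+1 A f ->
  (forall x, A x -> differentiable f x) /\ forall v, diff_upto k A ('D_v f).
Proof. by []. Qed.

Lemma diff_upto_diff (R : realType) (V W : normedModType R) k (A : set V) (f : V -> W) x :
  diff_upto k A f -> A x -> differentiable f x.
Proof. by case: k => [|k] []; auto. Qed.

Lemma diff_uptoW (R : realType) (V W : normedModType R) k (A : set V) (f : V -> W) :
  diff_upto k.+1 A f -> diff_upto k A f.
Proof.
elim: k f => [|k IHk] f [df Df]; split=> // v; exact/IHk/Df.
Qed.

Lemma smooth_onP (R : realType) (V W : normedModType R) (A : set V) (f : V -> W) :
  smooth_on A f <-> forall k, diff_upto k A f.
Proof.
split=> [sf k|].
  elim: k f sf => [|k IHk] f sf; (split=> [x Ax|]; first exact: (sf [::] x Ax)) => // v.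
  by apply: IHk => s x Ax; exact: (sf (v :: s)).
move=> df s; elim: s f df => [|v s IHs] f df x Ax /=.
  exact: diff_upto_diff (df 0%N) Ax.
by apply: IHs => // k; have [] := diff_uptoS (df k.+1).
Qed.

Lemma near_eq_differentiable (R : realType) (V W : normedModType R)
    (f g : V -> W) (x : V) :
  (\near x, f x = g x) -> differentiable f x -> differentiable g x.
Proof.
move=> fg df.
have fgx : f x = g x by exact: nbhs_singleton fg.
have [dc Ef] := (diff_locallyP x f).1 df.
have Eg : g \o shift x = cst (g x) + 'd f x +o_ 0 id.
  apply/eqaddoP => e e0.
  move/eqaddoP : Ef => /(_ e e0).
  have fg0 : \forall h \near 0, f (h + x) = g (h + x).
    move: fg; rewrite (near_shift 0) subr0; exact.
  apply: filter_app; near=> h.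
  have fgh : f (h + x) = g (h + x) by near: h.
  rewrite -[(g \o _ - _) h]/(g (h + x) - _) -[(f \o _ - _) h]/(f (h + x) - _).
  by rewrite fgh -[((cst (f x)) + _) h]/(f x + _) fgx.
have E := diff_unique dc Eg.
by apply/diff_locallyP; rewrite E.
Unshelve. all: by end_near. Qed.

Lemma open_near_eq (V : topologicalType) (W : Type) (A : set V) (f g : V -> W) x :
  open A -> A x -> (forall x, A x -> f x = g x) -> \near x, f x = g x.
Proof. by move=> oA Ax fg; near=> y; apply: fg; near: y; exact: open_nbhs_nbhs. Unshelve. all: by end_near. Qed.

Lemma diff_upto_eq (R : realType) (V W : normedModType R) k (A : set V) (f g : V -> W) :
  open A -> (forall x, A x -> f x = g x) -> diff_upto k A f -> diff_upto k A g.
Proof.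
move=> oA; elim: k f g => [|k IHk] f g fg [df Df]; split=> //.
- by move=> x Ax; apply: near_eq_differentiable (df x Ax); exact: open_near_eq Ax fg.
- by move=> x Ax; apply: near_eq_differentiable (df x Ax); exact: open_near_eq Ax fg.
move=> v; apply: IHk (Df v) => x Ax.
by apply: near_eq_derive; exact: open_near_eq Ax fg.
Qed.

Lemma diff_upto_cst (R : realType) (V W : normedModType R) k (A : set V) (c : W) :
  diff_upto k A (cst c).
Proof.
elim: k c => [|k IHk] c; split=> //; try by move=> *; exact: differentiable_cst.
move=> v; rewrite (_ : 'D_v (cst c) = cst 0); first exact: IHk.
by apply/funext => x; rewrite derive_cst.
Qed.

Lemma diff_upto_linear (R : realType) (V W : normedModType R) k (A : set V) (f : {linear V -> W}) :
  continuous f -> diff_upto k A f.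
Proof.
move=> cf; case: k => [|k]; split=> //; try by move=> *; exact: linear_differentiable.
move=> v; rewrite (_ : 'D_v f = cst (f v)); first exact: diff_upto_cst.
by apply/funext => x; rewrite deriveE ?diff_lin//; exact: linear_differentiable.
Qed.

Lemma diff_uptoD (R : realType) (V W : normedModType R) k (A : set V) (f g : V -> W) :
  open A -> diff_upto k A f -> diff_upto k A g -> diff_upto k A (f + g).
Proof.
move=> oA; elim: k f g => [|k IHk] f g [df Df] [dg Dg]; split=> //;
  try by move=> x Ax; apply: differentiableD; auto.
move=> v; apply: (@diff_upto_eq _ _ _ _ _ ('D_v f + 'D_v g)) => // [x Ax|].
  by rewrite deriveD//; apply: diff_derivable; auto.
by apply: IHk; [exact: Df|exact: Dg].
Qed.

Lemma diff_uptoM (R : realType) (V : normedModType R) k (A : set V) (f g : V -> R) :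
  open A -> diff_upto k A f -> diff_upto k A g -> diff_upto k A (f * g).
Proof.
move=> oA; elim: k f g => [|k IHk] f g df dg; split=> //;
  try by move=> x Ax; apply: differentiableM; [exact: diff_upto_diff df _|exact: diff_upto_diff dg _].
move=> v; apply: (@diff_upto_eq _ _ _ _ _ (f * 'D_v g + g * 'D_v f)) => // [x Ax|].
  by rewrite deriveM//; apply: diff_derivable; [exact: diff_upto_diff df _|exact: diff_upto_diff dg _].
by apply: diff_uptoD => //; apply: IHk; first [exact: diff_uptoW | exact: df.2 | exact: dg.2].
Qed.

Lemma diff_uptoZl (R : realType) (V W : normedModType R) k (A : set V) (f : V -> R) (w : W) :
  open A -> diff_upto k A f -> diff_upto k A (fun x => f x *: w).
Proof.
move=> oA; elim: k f => [|k IHk] f df; split=> //;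
  try by move=> x Ax; apply: differentiableZl; exact: diff_upto_diff df _.
move=> v; apply: (@diff_upto_eq _ _ _ _ _ (fun x => 'D_v f x *: w)) => // [x Ax|].
  have dfx := diff_upto_diff df Ax.
  by rewrite !deriveE// ?diffZl//; exact: differentiableZl.
by apply: IHk; exact: df.2.
Qed.

Lemma diff_upto_sum (R : realType) (V W : normedModType R) k (A : set V) n (f : 'I_n -> V -> W) :
  open A -> (forall i, diff_upto k A (f i)) -> diff_upto k A (\sum_(i < n) f i).
Proof.
move=> oA df; elim/big_ind: _ => [|g h dg dh|i _]; last exact: df.
  exact: diff_upto_cst.
exact: diff_uptoD.
Qed.

Lemma diff_upto_coord (R : realType) (V : normedModType R) k (A : set V) n (f : V -> 'rV[R]_n) j :
  open A -> diff_upto k A f -> diff_upto k A (fun x => f x ord0 j : R).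
Proof.
move=> oA; elim: k f => [|k IHk] f df; split=> //; 
  try by (move=> x Ax; apply: (@differentiable_comp _ _ _ _ f (fun M : 'rV[R]_n => M ord0 j : R));
    [exact: diff_upto_diff df Ax|exact: differentiable_coord]).
move=> v; apply: (@diff_upto_eq _ _ _ _ _ (fun x => 'D_v f x ord0 j : R)) => // [x Ax|].
  by rewrite derive_mx ?mxE//; exact/diff_derivable/(diff_upto_diff df).
by apply: IHk; exact: df.2.
Qed.

Lemma diff_upto_comp1 (R : realType) (V : normedModType R) k n (A : set V) (B : set 'rV[R]_n)
    (f : V -> 'rV[R]_n) (g : 'rV[R]_n -> R) :
  open A -> (forall x, A x -> B (f x)) ->
  diff_upto k A f -> diff_upto k B g -> diff_upto k A (g \o f).
Proof.
move=> oA AB; elim: k g => [|k IHk] g df dg; split=> //;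
  try by (move=> x Ax; apply: (differentiable_comp (diff_upto_diff df Ax)); exact: (diff_upto_diff dg (AB _ Ax))).
move=> v.
apply: (@diff_upto_eq _ _ _ _ _ (\sum_(j < n)
    (fun x => 'D_v f x ord0 j : R) * ('D_(delta_mx ord0 j) g \o f))) => // [x Ax|].
  have dfx := diff_upto_diff df Ax; have dgx := diff_upto_diff dg (AB _ Ax).
  rewrite deriveE; last exact: differentiable_comp.
  rewrite diff_comp//= -(deriveE v dfx) fct_sumE.
  rewrite [in RHS](row_sum_delta ('D_v f x)) linear_sum; apply: eq_bigr => j _.
  by rewrite linearZ/= -[in RHS](deriveE _ dgx).
apply: diff_upto_sum => // j; apply: diff_uptoM => //.
  by apply: diff_upto_coord => //; exact: df.2.
by apply: IHk; [exact: diff_uptoW|exact: dg.2].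
Qed.

Lemma smooth_on_comp (R : realType) (V : normedModType R) m n (A : set V)
    (B : set 'rV[R]_n) (f : V -> 'rV[R]_n) (g : 'rV[R]_n -> 'rV[R]_m) :
  open A -> open B -> (forall x, A x -> B (f x)) ->
  smooth_on A f -> smooth_on B g -> smooth_on A (g \o f).
Proof.
move=> oA oB AB /smooth_onP df /smooth_onP dg; apply/smooth_onP => k.
have -> : g \o f =
    \sum_(j < m) (fun x => (g (f x) ord0 j : R) *: (delta_mx ord0 j : 'rV[R]_m)).
  by apply/funext => x; rewrite fct_sumE -row_sum_delta.
apply: diff_upto_sum => // j; apply: diff_uptoZl => //.
apply: (diff_upto_comp1 (g := fun y => g y ord0 j) oA AB (df k)).
exact: diff_upto_coord.
Qed.

Lemma smooth_on_eq (R : realType) (V W : normedModType R) (A : set V) (f g : V -> W) :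
  open A -> (forall x, A x -> f x = g x) -> smooth_on A f -> smooth_on A g.
Proof. by move=> oA fg /smooth_onP df; apply/smooth_onP => k; exact: diff_upto_eq fg (df k). Qed.

Lemma smooth_on_id (R : realType) (V : normedModType R) (A : set V) : smooth_on A id.
Proof. by apply/smooth_onP => k; apply: (@diff_upto_linear _ _ _ _ _ idfun) => x. Qed.

Lemma smooth_on_cst (R : realType) (V W : normedModType R) (A : set V) (c : W) :
  smooth_on A (cst c).
Proof. by apply/smooth_onP => k; exact: diff_upto_cst. Qed.

Record aff (R : realType) := Aff {
  aff_dim : nat;
  aff_set :> set 'rV[R]_aff_dim;
  aff_open : open aff_set }.

(* As the domain is open, the derivatives at its points do not depend on the
   extension g of f to the whole vector space. *)
Definition smooth_map (R : realType) (U V : aff R) (f : U -> V) : Prop :=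
  exists2 g : 'rV[R]_(aff_dim U) -> 'rV[R]_(aff_dim V),
    smooth_on U g & forall u : U, val (f u) = g (val u).

Record hom (R : realType) (U V : aff R) := Hom {
  hom_fun :> U -> V;
  hom_smooth : smooth_map hom_fun }.

Lemma hom_eq (R : realType) (U V : aff R) (f g : hom U V) : f =1 g -> f = g.
Proof.
case: f g => [f sf] [g sg] /= /funext fg; rewrite fg in sf *.
by rewrite (Prop_irrelevance sf sg).
Qed.

Lemma smooth_map_id (R : realType) (U : aff R) : smooth_map (@id U).
Proof. by exists id => //; exact: smooth_on_id. Qed.

Lemma smooth_map_comp (R : realType) (U V W : aff R) (g : V -> W) (f : U -> V) :
  smooth_map g -> smooth_map f -> smooth_map (g \o f).
Proof.
move=> [G sG gG] [F sF fF]; exists (G \o F) => [|u /=]; last by rewrite gG fF.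
apply: smooth_on_comp sF sG; [exact: aff_open|exact: aff_open|] => x Ux.
rewrite -(fF (exist _ x (mem_set Ux))); exact/set_mem/valP.
Qed.

Definition hom_id (R : realType) (U : aff R) : hom U U := Hom (smooth_map_id U).

Definition hom_comp (R : realType) (U V W : aff R) (g : hom V W) (f : hom U V)
  : hom U W := Hom (smooth_map_comp (hom_smooth g) (hom_smooth f)).

Lemma hom_comp1 (R : realType) (U V : aff R) (f : hom U V) :
  hom_comp f (hom_id U) = f.
Proof. exact: hom_eq. Qed.

Lemma hom_compA (R : realType) (U V W X : aff R) (h : hom W X) (g : hom V W)
    (f : hom U V) :
  hom_comp h (hom_comp g f) = hom_comp (hom_comp h g) f.
Proof. exact: hom_eq. Qed.

Definition hom_iso (R : realType) (U V : aff R) (f : hom U V) : Prop :=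
  exists g : hom V U, hom_comp g f = hom_id U /\ hom_comp f g = hom_id V.

Definition open_embedding (R : realType) (U X : aff R) (f : hom U X) : Prop :=
  exists (A : set 'rV[R]_(aff_dim X)) (oA : open A) (e : hom U (Aff oA)),
    hom_iso e /\ forall u : U, val (f u) = val (e u).

Record pullback (R : realType) (U V X : aff R) (f : hom U X) (g : hom V X) :=
  Pullback {
    pb_obj : aff R;
    pb_fst : hom pb_obj U;
    pb_snd : hom pb_obj V;
    pb_comm : hom_comp f pb_fst = hom_comp g pb_snd;
    pb_univ : forall (T : aff R) (a : hom T U) (b : hom T V),
      hom_comp f a = hom_comp g b ->
      exists! c : hom T pb_obj, hom_comp pb_fst c = a /\ hom_comp pb_snd c = b }.

Lemma hom_comp_fun (R : realType) (U V V' W : aff R) (g : hom V W) (f : hom U V)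
    (g' : hom V' W) (f' : hom U V') u :
  hom_comp g f = hom_comp g' f' -> g (f u) = g' (f' u).
Proof. exact: (congr1 (fun h : hom U W => h u)). Qed.

Lemma smooth_map_restr (R : realType) (U X : aff R) (A : set 'rV[R]_(aff_dim X))
    (oA : open A) (f : U -> X) (g : U -> Aff oA) :
  (forall u, val (f u) = val (g u)) -> smooth_map f <-> smooth_map g.
Proof. by move=> fg; split=> -[h sh E]; exists h => // u; rewrite -?E fg. Qed.

Lemma open_embedding_inj (R : realType) (U X : aff R) (f : hom U X) :
  open_embedding f -> injective f.
Proof.
move=> [A [oA [e [[e' [e'e _]] fe]]]] u v /(congr1 val); rewrite !fe => /val_inj.
move=> /(congr1 e'); rewrite -[LHS]/(hom_comp e' e u) -[RHS]/(hom_comp e' e v).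
by rewrite e'e.
Qed.

Lemma smooth_continuous (R : realType) (V W : normedModType R) (A : set V)
    (f : V -> W) x : smooth_on A f -> A x -> {for x, continuous f}.
Proof. by move=> sf Ax; apply: differentiable_continuous; exact: (sf [::]). Qed.

Lemma open_preimage (R : realType) (U : aff R) (W : normedModType R)
    (F : 'rV[R]_(aff_dim U) -> W) (A : set W) :
  smooth_on U F -> open A -> open (U `&` F @^-1` A).
Proof.
move=> sF oA; rewrite openE => x [Ux Ax]; apply: filterI.
  by apply: open_nbhs_nbhs; split=> //; exact: aff_open.
by apply: (smooth_continuous sF Ux); exact: open_nbhs_nbhs.
Qed.

Lemma pullback_exists (R : realType) (U V X : aff R) (f : hom U X)
    (g : hom V X) : open_embedding g -> exists _ : pullback f g, True.
Proof.
move=> emb_g; have g_inj := open_embedding_inj emb_g.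
have [A [oA [e [[e' [e'e ee']] ge]]]] := emb_g.
have [F sF fF] := hom_smooth f.
have oP := open_preimage sF oA; set P : aff R := Aff oP.
have PU (p : P) : val p \in (U : set _) by exact/mem_set/(set_mem (valP p)).1.
pose p1 (p : P) : U := exist _ (val p) (PU p).
have PA (p : P) : val (f (p1 p)) \in A.
  by rewrite fF /=; exact/mem_set/(set_mem (valP p)).2.
pose q (p : P) : Aff oA := exist _ (val (f (p1 p))) (PA p).
have sp1 : smooth_map p1 by exists id => //; exact: smooth_on_id.
have sq : smooth_map q.
  have [+ _] := @smooth_map_restr R P X A oA (f \o p1) q (fun p => erefl).
  by apply; exact: smooth_map_comp (hom_smooth f) sp1.
pose P1 := Hom sp1; pose P2 := hom_comp e' (Hom sq).
have ge' (a : Aff oA) : val (g (e' a)) = val a.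
  by rewrite ge -[e _]/(hom_comp e e' a) ee'.
have comm : hom_comp f P1 = hom_comp g P2.
  by apply: hom_eq => p; apply: val_inj; rewrite /= ge'.
suff univ : forall (T : aff R) (a : hom T U) (b : hom T V),
    hom_comp f a = hom_comp g b ->
    exists! c : hom T P, hom_comp P1 c = a /\ hom_comp P2 c = b.
  by exists (Pullback comm univ).
move=> T a b /(congr1 (fun h : hom T X => h : T -> X)) ab.
have fagb t : f (a t) = g (b t) by exact: (congr1 (@^~ t) ab).
have aP t : val (a t) \in U `&` F @^-1` A.
  apply/mem_set; split; first exact/set_mem/valP.
  by rewrite /preimage/= -fF fagb ge; exact/set_mem/valP.
pose c t : P := exist _ (val (a t)) (aP t).
have sc : smooth_map c.
  by have [G sG aG] := hom_smooth a; exists G => // t; rewrite -aG.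
have P1c : hom_comp P1 (Hom sc) = a by apply: hom_eq => t; exact: val_inj.
have P2c : hom_comp P2 (Hom sc) = b.
  apply: hom_eq => t; apply: g_inj; apply: val_inj.
  by rewrite ge' /= -fagb; congr (val (f _)); exact: val_inj.
exists (Hom sc); split=> // c' [P1c' _]; apply: hom_eq => t; apply: val_inj.
by have /(congr1 (fun h : hom T U => val (h t))) := P1c'.
Qed.

Definition fibre_product (R : realType) (U V X : aff R) (f : hom U X)
    (g : hom V X) (emb_g : open_embedding g) : pullback f g :=
  projT1 (cid (pullback_exists f emb_g)).

(* A family of principal opens, not required to be jointly surjective. *)
Record family (R : realType) (X : aff R) := Family {
  fam_idx : Type;
  fam_obj : fam_idx -> aff R;
  fam_map : forall i, hom (fam_obj i) X;
  fam_emb : forall i, open_embedding (fam_map i) }.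

Definition covering (R : realType) (X : aff R) (S : family X) : Prop :=
  forall x : X, exists (i : fam_idx S) (u : fam_obj i), fam_map i u = x.

Definition fam_pb (R : realType) (X : aff R) (S : family X) (i j : fam_idx S)
  : pullback (fam_map i) (fam_map j) := fibre_product (fam_map i) (fam_emb j).

Record presheaf (R : realType) := Presheaf {
  psh :> aff R -> Type;
  res : forall U V : aff R, hom U V -> psh V -> psh U;
  res_id : forall (U : aff R) (s : psh U), res (hom_id U) s = s;
  res_comp : forall (U V W : aff R) (g : hom V W) (f : hom U V) (s : psh W),
    res (hom_comp g f) s = res f (res g s) }.

Definition is_sheaf (R : realType) (F : presheaf R) : Prop :=
  forall (X : aff R) (S : family X), covering S ->
  forall s : forall i : fam_idx S, F (fam_obj i),
  (forall i j, res (pb_fst (fam_pb i j)) (s i) = res (pb_snd (fam_pb i j)) (s j)) ->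
  exists! t : F X, forall i, res (fam_map i) t = s i.

Record sheaf (R : realType) := Sheaf {
  sheaf_psh :> presheaf R;
  sheafP : is_sheaf sheaf_psh }.

Record sheaf_hom (R : realType) (F G : sheaf R) := SheafHom {
  shom_fun :> forall U : aff R, F U -> G U;
  shom_natural : forall (U V : aff R) (f : hom U V) (s : F V),
    shom_fun (res f s) = res f (shom_fun s) }.

Lemma sheaf_hom_eq (R : realType) (F G : sheaf R) (a b : sheaf_hom F G) :
  (forall U s, a U s = b U s) -> a = b.
Proof.
case: a b => [a na] [b nb] /= ab; have {}ab : a = b.
  by apply: functional_extensionality_dep => U; apply/funext => s.
by rewrite ab in na *; rewrite (Prop_irrelevance na nb).
Qed.

Definition shom_id (R : realType) (F : sheaf R) : sheaf_hom F F :=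
  @SheafHom R F F (fun U => id) (fun U V f s => erefl).

Lemma shom_comp_natural (R : realType) (F G H : sheaf R) (b : sheaf_hom G H)
    (a : sheaf_hom F G) (U V : aff R) (f : hom U V) (s : F V) :
  b U (a U (res f s)) = res f (b V (a V s)).
Proof. by rewrite !shom_natural. Qed.

Definition shom_comp (R : realType) (F G H : sheaf R) (b : sheaf_hom G H)
    (a : sheaf_hom F G) : sheaf_hom F H :=
  SheafHom (shom_comp_natural b a).

Definition rep_presheaf (R : realType) (X : aff R) : presheaf R :=
  @Presheaf R (fun U => hom U X) (fun U V f s => hom_comp s f)
    (fun U s => hom_comp1 s) (fun U V W g f s => hom_compA s g f).

Lemma pullback_pt (R : realType) (U V X : aff R) (f : hom U X) (g : hom V X)
    (P : pullback f g) (u : U) (v : V) :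
  f u = g v -> exists p, pb_fst P p = u /\ pb_snd P p = v.
Proof.
move=> fugv; pose pt : aff R := @Aff R 0 setT openT.
have sc (Y : aff R) (y : Y) : smooth_map (fun _ : pt => y).
  by exists (cst (val y)) => //; exact: smooth_on_cst.
have [|c [[c1 c2] _]] := pb_univ P (a := Hom (sc U u)) (b := Hom (sc V v)).
  by apply: hom_eq => t /=.
pose t : pt := exist _ 0 (mem_set I).
exists (c t); split.
  exact: (congr1 (fun h : hom pt U => h t) c1).
exact: (congr1 (fun h : hom pt V => h t) c2).
Qed.

Lemma rep_is_sheaf (R : realType) (Y : aff R) : is_sheaf (rep_presheaf Y).
Proof.
move=> X S cov s sE.
have match_s i j (u : fam_obj i) (v : fam_obj j) :
    fam_map i u = fam_map j v -> s i u = s j v.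
  move=> /(pullback_pt (fam_pb i j)) [p [<- <-]].
  exact: (congr1 (fun h : hom _ Y => h p) (sE i j)).
have cov' (x : X) : exists w : {i : fam_idx S & fam_obj i},
    fam_map (projT1 w) (projT2 w) = x.
  by have [i [u ux]] := cov x; exists (existT _ i u).
have [w wE] := choice cov'.
pose t x := s (projT1 (w x)) (projT2 (w x)).
have tE i (u : fam_obj i) : t (fam_map i u) = s i u by exact/match_s/wE.
have st : smooth_map t.
  pose G x := if pselect ((X : set _) x) is left Xx then val (t (exist _ x (mem_set Xx))) else 0.
  have GE (x : X) : val (t x) = G (val x).
    rewrite /G; case: pselect => [Xx|[]]; last exact/set_mem/valP.
    by congr (val (t _)); exact: val_inj.
  exists G => // k x Xx.
  have [i [u ux]] := cov (exist _ x (mem_set Xx)).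
  have [A [oA [e [[e' [e'e ee']] fe]]]] := fam_emb i.
  have [H sH HE] := hom_smooth (hom_comp (s i) e').
  have Ax : A x.
    by rewrite -[x]/(val (exist _ x (mem_set Xx) : X)) -ux fe; exact/set_mem/valP.
  suff sG : smooth_on A G by exact: sG.
  apply: (smooth_on_eq oA _ sH) => y Ay.
  pose a : Aff oA := exist _ y (mem_set Ay).
  have fa : val (fam_map i (e' a)) = y.
    by rewrite fe -[e _]/(hom_comp e e' a) ee'.
  by rewrite -[y in G y]fa -GE tE -[y]/(val a) -HE.
exists (Hom st); split=> [i|t' t'E]; first by apply: (@hom_eq R (fam_obj i) Y) => u; exact: tE.
by apply: (@hom_eq R X Y) => x; have [i [u <-]] := cov x; rewrite [LHS]tE -t'E.
Qed.

Definition rep (R : realType) (X : aff R) : sheaf R := Sheaf (@rep_is_sheaf R X).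

Definition rep_map (R : realType) (U V : aff R) (f : hom U V)
  : sheaf_hom (rep U) (rep V) :=
  @SheafHom R (rep U) (rep V) (fun T a => hom_comp f a)
    (fun T T' b a => hom_compA f a b).

Record diagram (R : realType) := Diagram {
  node : Type;
  edge : node -> node -> Type;
  dob : node -> sheaf R;
  darr : forall a b : node, edge a b -> sheaf_hom (dob a) (dob b) }.

Record cocone (R : realType) (D : diagram R) (F : sheaf R) := Cocone {
  leg :> forall a : node D, sheaf_hom (dob a) F;
  leg_comm : forall (a b : node D) (e : edge a b),
    shom_comp (leg b) (darr e) = leg a }.

Definition is_colimit (R : realType) (D : diagram R) (F : sheaf R)
    (c : cocone D F) : Prop :=
  forall (G : sheaf R) (d : cocone D G),
  exists! h : sheaf_hom F G, forall a : node D, shom_comp h (c a) = d a.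

Inductive atlas_edge (I : Type) : I + I * I -> I + I * I -> Type :=
| Edge1 (i j : I) : atlas_edge (inr (i, j)) (inl i)
| Edge2 (i j : I) : atlas_edge (inr (i, j)) (inl j).

Definition atlas_obj (R : realType) (X : aff R) (S : family X)
    (a : fam_idx S + fam_idx S * fam_idx S) : aff R :=
  match a with
  | inl i => fam_obj i
  | inr (i, j) => pb_obj (fam_pb i j)
  end.

Definition atlas_proj (R : realType) (X : aff R) (S : family X)
    (a b : fam_idx S + fam_idx S * fam_idx S) (e : atlas_edge a b)
  : hom (atlas_obj a) (atlas_obj b) :=
  match e in atlas_edge a b return hom (atlas_obj a) (atlas_obj b) with
  | Edge1 i j => pb_fst (fam_pb i j)
  | Edge2 i j => pb_snd (fam_pb i j)
  end.

(* Nodes: the U_i (inl) and the U_ij (inr); edges: the two projections. *)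
Definition atlas (R : realType) (X : aff R) (S : family X) : diagram R :=
  @Diagram R (fam_idx S + fam_idx S * fam_idx S)%type (@atlas_edge (fam_idx S))
    (fun a => rep (atlas_obj a)) (fun a b e => rep_map (atlas_proj e)).

(* The second component p is the canonical map: the one induced on the colimit
   by the morphisms of S. *)
Definition is_open_immersion (R : realType) (X : aff R) (F : sheaf R)
    (p : sheaf_hom F (rep X)) : Prop :=
  exists (S : family X) (c : cocone (atlas S) F), is_colimit c /\
    forall i : fam_idx S, shom_comp p (c (inl i)) = rep_map (fam_map i).

Record open_immersion (R : realType) (X : aff R) := OpenImmersion {
  oi_sheaf : sheaf R;
  oi_map : sheaf_hom oi_sheaf (rep X);
  oi_prop : is_open_immersion oi_map }.

Definition oi_iso (R : realType) (X : aff R) (U V : open_immersion X) : Prop :=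
  exists (f : sheaf_hom (oi_sheaf U) (oi_sheaf V))
         (g : sheaf_hom (oi_sheaf V) (oi_sheaf U)),
  [/\ shom_comp g f = shom_id (oi_sheaf U),
      shom_comp f g = shom_id (oi_sheaf V) &
      shom_comp (oi_map V) f = oi_map U].

Definition oi_factors (R : realType) (X : aff R) (V U : open_immersion X) : Prop :=
  exists f : sheaf_hom (oi_sheaf V) (oi_sheaf U),
    shom_comp (oi_map U) f = oi_map V.

(* An isomorphism class. It consists of sheaves, and therefore lives in a
   universe above those accepted by [set] and [topologicalType]: subsets are
   plain predicates from here on. *)
Record open_subscheme (R : realType) (X : aff R) := OpenSubscheme {
  os_class :> open_immersion X -> Prop;
  os_classP : exists U, forall V, os_class V <-> oi_iso U V }.

Lemma oi_class_proof (R : realType) (X : aff R) (U : open_immersion X) :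
  exists U', forall V, oi_iso U V <-> oi_iso U' V.
Proof. by exists U. Qed.

Definition oi_class (R : realType) (X : aff R) (U : open_immersion X)
  : open_subscheme X := OpenSubscheme (oi_class_proof U).

Definition os_le (R : realType) (X : aff R) (v u : open_subscheme X) : Prop :=
  exists V U : open_immersion X, [/\ v V, u U & oi_factors V U].

Definition single (R : realType) (U X : aff R) (f : hom U X)
    (emb_f : open_embedding f) : family X :=
  @Family R X unit (fun=> U) (fun=> f) (fun=> emb_f).

Lemma open_embedding_is_open_immersion (R : realType) (U X : aff R)
  (f : hom U X) : open_embedding f -> is_open_immersion (rep_map f).
Proof.
move=> emb_f; exists (single emb_f).
pose S := single emb_f.
have pbE (i j : fam_idx S) : pb_fst (fam_pb i j) = pb_snd (fam_pb i j).
  apply: hom_eq => x; apply: (open_embedding_inj emb_f).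
  exact: (hom_comp_fun x (pb_comm (fam_pb i j))).
pose l (a : node (atlas S)) : sheaf_hom (dob a) (rep U) :=
  match a return sheaf_hom (rep (atlas_obj (S := S) a)) (rep U) with
  | inl i => rep_map (hom_id U)
  | inr (i, j) => rep_map (pb_fst (fam_pb (S := S) i j))
  end.
have lE (a b : node (atlas S)) (e : edge a b) : shom_comp (l b) (darr e) = l a.
  by case: e => i j; apply: sheaf_hom_eq => T s; apply: hom_eq => x //=; rewrite pbE.
exists (Cocone lE); split; last first.
  by case; apply: sheaf_hom_eq => T s; exact: hom_eq.
move=> G d; exists (d (inl tt)); split=> [[[]|[[] []]]|h hE].
- by apply: sheaf_hom_eq => T s; apply: (congr1 (d (inl tt) T)); exact: hom_eq.
- by rewrite -(leg_comm d (Edge1 tt tt)); apply: sheaf_hom_eq => T s.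
- by rewrite -(hE (inl tt)); apply: sheaf_hom_eq => T s; apply: (congr1 (h T)); exact: hom_eq.
Qed.

Lemma inclusion_smooth (R : realType) (X : aff R) (A : set 'rV[R]_(aff_dim X))
    (oA : open A) (AX : A `<=` X) :
  smooth_map (fun a : Aff oA => exist _ (val a) (mem_set (AX _ (set_mem (valP a)))) : X).
Proof. by exists id => //; exact: smooth_on_id. Qed.

Definition inclusion (R : realType) (X : aff R) (A : set 'rV[R]_(aff_dim X))
    (oA : open A) (AX : A `<=` X) : hom (Aff oA) X := Hom (inclusion_smooth oA AX).

Lemma inclusion_open_embedding (R : realType) (X : aff R)
    (A : set 'rV[R]_(aff_dim X)) (oA : open A) (AX : A `<=` X) :
  open_embedding (inclusion oA AX).
Proof.
exists A, oA, (hom_id _); split=> //.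
by exists (hom_id _); split; exact: hom_eq.
Qed.

(* [A -> X] for an open subset A of X *)
Definition open_class (R : realType) (X : aff R) (A : set 'rV[R]_(aff_dim X))
    (oA : open A) (AX : A `<=` X) : open_subscheme X :=
  oi_class (OpenImmersion (open_embedding_is_open_immersion
    (inclusion_open_embedding oA AX))).

Lemma open_remove (R : realType) (X : aff R) (x : X) : open (X `\ val x).
Proof.
apply: openI; first exact: aff_open.
apply: closed_openC; exact/accessible_closed_set1/hausdorff_accessible/norm_hausdorff.
Qed.

(* [X \ {x} -> X] *)
Definition point_complement (R : realType) (X : aff R) (x : X) : open_subscheme X :=
  open_class (@open_remove R X x) (@subDsetl _ (X : set _) [set val x]).

Definition is_sup (T : Type) (le : T -> T -> Prop) (A : T -> Prop) (s : T) : Prop :=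
  (forall a, A a -> le a s) /\ (forall b, (forall a, A a -> le a b) -> le s b).

Definition is_inf (T : Type) (le : T -> T -> Prop) (A : T -> Prop) (s : T) : Prop :=
  (forall a, A a -> le s a) /\ (forall b, (forall a, A a -> le b a) -> le b s).

Definition is_meet (T : Type) (le : T -> T -> Prop) (a b m : T) : Prop :=
  is_inf le (fun x => x = a \/ x = b) m.

(* A frame, with least upper and greatest lower bounds as relations. *)
Record is_locale (T : Type) (le : T -> T -> Prop) : Prop := IsLocale {
  loc_refl : forall a, le a a;
  loc_trans : forall a b c, le a b -> le b c -> le a c;
  loc_anti : forall a b, le a b -> le b a -> a = b;
  loc_sup : forall A : T -> Prop, exists s, is_sup le A s;
  loc_inf : forall A : T -> Prop, exists s, is_inf le A s;
  loc_distr : forall (a : T) (A : T -> Prop) (s m : T),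
    is_sup le A s -> is_meet le a s m ->
    is_sup le (fun x => exists2 b, A b & is_meet le a b x) m }.

Record locale := Locale {
  loc_sort :> Type;
  loc_le : loc_sort -> loc_sort -> Prop;
  loc_ax : is_locale loc_le }.

(* A morphism L -> M, given by the map in the opposite direction. *)
Record locale_hom (L M : locale) := LocaleHom {
  lh_fun :> M -> L;
  lh_bot : forall z : M, (forall a, loc_le z a) -> forall b, loc_le (lh_fun z) b;
  lh_top : forall z : M, (forall a, loc_le a z) -> forall b, loc_le b (lh_fun z);
  lh_sup : forall (A : M -> Prop) (s : M), is_sup (@loc_le M) A s ->
    is_sup (@loc_le L) (fun y => exists2 a, A a & y = lh_fun a) (lh_fun s);
  lh_meet : forall a b m : M, is_meet (@loc_le M) a b m ->
    is_meet (@loc_le L) (lh_fun a) (lh_fun b) (lh_fun m) }.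

Lemma bool_is_locale : is_locale (fun a b : bool => a ==> b).
Proof.
have supB (A : bool -> Prop) : is_sup (fun a b : bool => a ==> b) A `[< A true >].
  split=> [[] Aa //=|[] // b]; first exact/asboolP.
  - by rewrite implybT.
  by case: asboolP => //= At; exact: b At.
have infB (A : bool -> Prop) : is_inf (fun a b : bool => a ==> b) A (~~ `[< A false >]).
  split=> [[]|b bA]; rewrite ?implybT //.
    by move=> Af; rewrite (asboolT Af).
  by case: b bA => //= bA; apply/negP => /asboolP /bA.
split.
- by case.
- by case=> [] [] [].
- by case=> [] [].
- by move=> A; exists `[< A true >]; exact: supB.
- by move=> A; exists (~~ `[< A false >]); exact: infB.
move=> a A s m [As sA] [ma mas]; split=> [x [b Ab [xb xab]]|c cub].
  apply: mas => y [->|->]; first by apply: xb; left.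
  by move: (xb b (or_intror erefl)) (As b Ab); case: (x) (b) (s) => [] [] [].
case: m ma {mas} => //= ma.
have aT : a = true by apply: ma; left.
have sT : s = true by apply: ma; right.
have AT : A true.
  apply: contrapT => nAT; move: (sA false); rewrite sT => /(_ _)/negP; case=> //.
  by case.
apply: (cub true); exists true => //; rewrite aT; split=> [y [->|->]|] //.
by move=> b _; rewrite implybT.
Qed.

(* 0 = false and 1 = true *)
Definition loc1 : locale := Locale bool_is_locale.

Definition stone (L : locale) : Type := locale_hom loc1 L.

Definition stone_open (L : locale) (O : stone L -> Prop) : Prop :=
  exists u : L, forall f, O f <-> f u = true.

Definition stone_homeomorphism (T : topologicalType) (L : locale)
    (phi : T -> stone L) : Prop :=
  exists psi : stone L -> T,
  [/\ cancel phi psi, cancel psi phi,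
      (forall O : stone L -> Prop, stone_open O -> open [set x | O (phi x)]) &
      (forall B : set T, open B -> stone_open (fun f => B (psi f)))].

Definition principal_ideal (L : locale) (u : L) : L -> Prop := fun v => loc_le v u.

Definition prime_ideal (L : locale) (I : L -> Prop) : Prop :=
  (exists v, ~ I v) /\
  (forall a b m, ~ I a -> ~ I b -> is_meet (@loc_le L) a b m -> ~ I m).

(* Main.v *)
Require Import Defs.
From mathcomp Require Import all_boot all_order all_algebra.
From mathcomp Require Import all_classical all_reals all_analysis.
Import numFieldNormedType.Exports.
(* [hom], [Hom] and [family] also name notions of the algebra library. *)
Import Defs.
Set Implicit Arguments.
Unset Strict Implicit.
Unset Printing Implicit Defensive.
Local Open Scope classical_set_scope.
Local Open Scope ring_scope.

(** Open subschemes of [X] are the same thing as open subsets of [X], so that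
    [Lambda_X] is the frame of opens of a Hausdorff space, from which the space
    can be recovered because Hausdorff spaces are sober.

    The geometric half is descent. Let [W] be the union of the images of a
    family of open embeddings [U_i -> X]. A cocone from the atlas to a sheaf [G]
    is a family of sections over the [U_i] that match over the [U_ij]; since the
    [U_i] cover the open set [W], these glue to a section of [G] over [W], which
    by Yoneda is a morphism from [W] to [G]. Hence [W] is the colimit of the
    atlas ([union_colimit]), and uniqueness of colimits makes every open
    immersion isomorphic over [X] to the inclusion of an open subset
    ([open_immersion_is_inclusion]). A morphism over [X] between two such
    inclusions exists exactly when the first subset is contained in the second,
    so taking images identifies the order of [Lambda_X] with inclusion of open
    subsets ([os_image_presents]).

    The topological half holds for any order isomorphic to the opens of a
    Hausdorff space [T] ([presents_opens]). Suprema are unions and binary meets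
    are intersections, which gives the locale axioms ([presents_locale]). Each
    point [x] is the frame map sending [u] to the truth value of [x \in u].
    Conversely, a frame map [f] sends a largest open set [W] to 0; the complement
    of [W] is non-empty because [f] preserves the top, and has no two distinct
    points because disjoint neighbourhoods of them would both be sent to 1 while
    their meet is sent to 0. Thus [W] is the complement of a point [x], and [f]
    is evaluation at [x] ([stone_point]). *)

(** * Uniqueness of colimits of sheaves *)

Lemma shom_comp1f (R : realType) (F G : sheaf R) (f : sheaf_hom F G) :
  shom_comp (shom_id G) f = f.
Proof. exact: sheaf_hom_eq. Qed.

Lemma shom_compf1 (R : realType) (F G : sheaf R) (f : sheaf_hom F G) :
  shom_comp f (shom_id F) = f.
Proof. exact: sheaf_hom_eq. Qed.

Lemma shom_compA (R : realType) (F G H K : sheaf R) (h : sheaf_hom H K)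
    (g : sheaf_hom G H) (f : sheaf_hom F G) :
  shom_comp h (shom_comp g f) = shom_comp (shom_comp h g) f.
Proof. exact: sheaf_hom_eq. Qed.

Lemma colimit_unique_map (R : realType) (D : diagram R) (F : sheaf R)
    (c : cocone D F) (G : sheaf R) (f g : sheaf_hom F G) :
  is_colimit c -> (forall a, shom_comp f (c a) = shom_comp g (c a)) -> f = g.
Proof.
move=> cC fg.
have dE (a b : node D) (e : edge a b) :
    shom_comp (shom_comp g (c b)) (darr e) = shom_comp g (c a).
  by rewrite -shom_compA leg_comm.
have [h [_ hu]] := cC G (Cocone dE).
by rewrite -(hu f fg) -(hu g).
Qed.

Lemma colimit_iso (R : realType) (D : diagram R) (F G : sheaf R)
    (c : cocone D F) (d : cocone D G) : is_colimit c -> is_colimit d ->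
  exists (f : sheaf_hom F G) (g : sheaf_hom G F),
  [/\ shom_comp g f = shom_id F, shom_comp f g = shom_id G &
      forall a, shom_comp f (c a) = d a].
Proof.
move=> cC dC; have [f [fE _]] := cC G d; have [g [gE _]] := dC F c.
exists f, g; split=> //.
  by apply: (colimit_unique_map cC) => a; rewrite -shom_compA fE gE shom_comp1f.
by apply: (colimit_unique_map dC) => a; rewrite -shom_compA gE fE shom_comp1f.
Qed.

(** * The union of a family of principal opens *)

Lemma corestriction (R : realType) (U X : aff R) (f : hom U X)
    (A : set 'rV[R]_(aff_dim X)) (oA : open A) :
  (forall u, A (val (f u))) ->
  exists g : hom U (Aff oA), forall u, val (g u) = val (f u).
Proof.
move=> fA; pose g u : Aff oA := exist _ (val (f u)) (mem_set (fA u)).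
have sg : smooth_map g by exact/(@smooth_map_restr _ _ _ _ oA f g _).1/hom_smooth.
by exists (Hom sg).
Qed.

Definition family_image (R : realType) (X : aff R) (S : family X)
  : set 'rV[R]_(aff_dim X) :=
  [set x | exists (i : fam_idx S) (u : fam_obj i), val (fam_map i u) = x].

Lemma family_image_open (R : realType) (X : aff R) (S : family X) :
  open (family_image S).
Proof.
rewrite openE => x [i [u <-]].
have [A [oA [e [[e' [_ ee']] fe]]]] := fam_emb i.
apply: (@filterS _ _ _ A); last first.
  by rewrite fe; apply: open_nbhs_nbhs; split=> //; exact/set_mem/valP.
move=> y Ay; pose a : Aff oA := exist _ y (mem_set Ay).
by exists i, (e' a); rewrite fe -[e _]/(hom_comp e e' a) ee'.
Qed.

Definition family_union (R : realType) (X : aff R) (S : family X) : aff R :=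
  Aff (@family_image_open R X S).

Lemma family_image_sub (R : realType) (X : aff R) (S : family X) :
  family_image S `<=` X.
Proof. by move=> x [i [u <-]]; exact/set_mem/valP. Qed.

Lemma family_corestriction (R : realType) (X : aff R) (S : family X)
    (i : fam_idx S) :
  exists g : hom (fam_obj i) (family_union S),
    forall u, val (g u) = val (fam_map i u).
Proof. by apply: corestriction => u; exists i, u. Qed.

Definition to_image (R : realType) (X : aff R) (S : family X) (i : fam_idx S)
  : hom (fam_obj i) (family_union S) :=
  projT1 (cid (family_corestriction i)).

Lemma to_imageE (R : realType) (X : aff R) (S : family X) (i : fam_idx S)
  (u : fam_obj i) : val (to_image i u) = val (fam_map i u).
Proof. by rewrite /to_image; case: cid. Qed.

Lemma to_image_embedding (R : realType) (X : aff R) (S : family X)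
  (i : fam_idx S) : open_embedding (to_image i).
Proof.
have [A [oA [e [e_iso fe]]]] := fam_emb i.
by exists A, oA, e; split=> // u; rewrite to_imageE.
Qed.

(** The maps to the union thus have the same fibre products as the maps to [X],
    which carries matching conditions between the atlas of [S] and the covering
    of its union. *)
Lemma to_image_eq (R : realType) (X : aff R) (S : family X) (i j : fam_idx S)
    (u : fam_obj i) (v : fam_obj j) :
  to_image i u = to_image j v <-> fam_map i u = fam_map j v.
Proof.
split=> [/(congr1 val)|/(congr1 val) uv]; first by rewrite !to_imageE => /val_inj.
by apply: val_inj; rewrite !to_imageE.
Qed.

Definition image_family (R : realType) (X : aff R) (S : family X)
  : family (family_union S) := Family (@to_image_embedding R X S).

Lemma image_family_covering (R : realType) (X : aff R) (S : family X) :
  covering (image_family S).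
Proof.
move=> x; have [i [u ux]] := set_mem (valP x).
by exists i, u; apply: val_inj; rewrite /= to_imageE.
Qed.

Definition union_leg (R : realType) (X : aff R) (S : family X)
    (a : node (atlas S)) : sheaf_hom (dob a) (rep (family_union S)) :=
  match a return sheaf_hom (rep (atlas_obj (S := S) a)) _ with
  | inl i => rep_map (to_image i)
  | inr (i, j) => rep_map (hom_comp (to_image i) (pb_fst (fam_pb i j)))
  end.

Lemma union_leg_comm (R : realType) (X : aff R) (S : family X)
    (a b : node (atlas S)) (e : edge a b) :
  shom_comp (union_leg b) (darr e) = union_leg a.
Proof.
case: e => i j; apply: sheaf_hom_eq => T s; apply: hom_eq => x //=.
exact/to_image_eq/esym/(hom_comp_fun (s x) (pb_comm (fam_pb i j))).
Qed.

Definition union_cocone (R : realType) (X : aff R) (S : family X)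
  : cocone (atlas S) (rep (family_union S)) :=
  Cocone (@union_leg_comm R X S).

(** A cocone over the atlas only speaks of the chosen fibre products [U_ij], but
    by their universal property every such pair [a], [b] comes from a point of
    [U_ij]. *)
Lemma cocone_match (R : realType) (X : aff R) (S : family X) (G : sheaf R)
    (d : cocone (atlas S) G) (i j : fam_idx S) (T : aff R)
    (a : hom T (fam_obj i)) (b : hom T (fam_obj j)) :
  hom_comp (fam_map i) a = hom_comp (fam_map j) b ->
  d (inl i) T a = d (inl j) T b.
Proof.
move=> /(pb_univ (fam_pb i j)) [q [[<- <-] _]].
have E1 := leg_comm d (Edge1 i j); have E2 := leg_comm d (Edge2 i j).
rewrite -[LHS]/(shom_comp (d (inl i)) (darr (d := atlas S) (Edge1 i j)) T q) E1.
by rewrite -[RHS]/(shom_comp (d (inl j)) (darr (d := atlas S) (Edge2 i j)) T q) E2.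
Qed.

(** By Yoneda a cocone to [G] is a family of sections [s i] of [G] over the
    [U_i]. These match over the covering of the union by the [U_i], and the
    sheaf axiom glues them to a section [g], that is, to a morphism from the
    union to [G]. *)
Lemma union_colimit (R : realType) (X : aff R) (S : family X) :
  is_colimit (union_cocone S).
Proof.
move=> G d; set W := family_union S.
pose s (i : fam_idx (image_family S)) : G (fam_obj i) :=
  d (inl i) (fam_obj i) (hom_id (fam_obj i)).
have dE (i : fam_idx S) T (t : hom T (fam_obj i)) : d (inl i) T t = res t (s i).
  by rewrite -(shom_natural (d (inl i))); congr (d _ T _); exact: hom_eq.
have sE i j : res (pb_fst (fam_pb (S := image_family S) i j)) (s i) =
    res (pb_snd (fam_pb (S := image_family S) i j)) (s j).
  rewrite -[LHS]dE -[RHS]dE; apply: cocone_match; apply: hom_eq => x.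
  exact/to_image_eq/(hom_comp_fun x (pb_comm (fam_pb (S := image_family S) i j))).
have [g [gE g_uniq]] := sheafP (@image_family_covering R X S) sE.
have h_nat (U V : aff R) (f : hom U V) (t : rep W V) :
    res (res f t : rep W U) g = res f (res t g) by exact: res_comp.
exists (@SheafHom R (rep W) G (fun T t => res t g) h_nat).
have hE (i : fam_idx S) T (t : hom T (fam_obj i)) :
    res (hom_comp (to_image i) t) g = d (inl i) T t.
  by rewrite res_comp dE -gE.
split=> [[i|[i j]]|h' h'E]; apply: sheaf_hom_eq => T t /=.
- exact: hE.
- rewrite -(leg_comm d (Edge1 i j)) /= -hE; congr (res _ g); exact: hom_eq.
rewrite (g_uniq (h' W (hom_id W))).
  by rewrite -shom_natural; congr (h' T _); exact: hom_eq.
move=> i; rewrite -shom_natural /s -(h'E (inl i)) /=; congr (h' _ _).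
exact: hom_eq.
Qed.

(** * Open subschemes are open subsets *)

Lemma oi_iso_refl (R : realType) (X : aff R) (U : open_immersion X) :
  oi_iso U U.
Proof. by exists (shom_id _), (shom_id _); split; exact: sheaf_hom_eq. Qed.

Lemma oi_iso_sym (R : realType) (X : aff R) (U V : open_immersion X) :
  oi_iso U V -> oi_iso V U.
Proof.
move=> [f [g [gf fg fE]]]; exists g, f; split=> //.
by rewrite -fE -shom_compA fg shom_compf1.
Qed.

Lemma oi_iso_trans (R : realType) (X : aff R) (U V W : open_immersion X) :
  oi_iso U V -> oi_iso V W -> oi_iso U W.
Proof.
move=> [f [g [gf fg fE]]] [f' [g' [gf' fg' fE']]].
exists (shom_comp f' f), (shom_comp g g'); split.
- by rewrite shom_compA -(shom_compA g) gf' shom_compf1.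
- by rewrite shom_compA -(shom_compA f') fg shom_compf1.
- by rewrite shom_compA fE'.
Qed.

Lemma os_classE (R : realType) (X : aff R) (u : open_subscheme X)
    (U : open_immersion X) : u U -> u = oi_class U.
Proof.
move=> uU; have E V : u V <-> oi_iso U V.
  have [W uE] := os_classP u; have WU := (uE U).1 uU.
  split=> [/uE|UV]; first exact/oi_iso_trans/oi_iso_sym.
  exact/uE/(oi_iso_trans WU).
case: u uU E => c cP /= _ E.
have {}E : c = oi_iso U by apply/funext => V; apply/propext.
by rewrite E in cP *; rewrite (Prop_irrelevance cP (oi_class_proof U)).
Qed.

Definition open_incl (R : realType) (X : aff R) (A : set 'rV[R]_(aff_dim X))
    (oA : open A) (AX : A `<=` X) : open_immersion X :=
  OpenImmersion (open_embedding_is_open_immersion (inclusion_open_embedding oA AX)).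

(** The sheaf of an open immersion and the union of its family are colimits of
    the same atlas, hence isomorphic. The isomorphism lies over [X]: both maps to
    [X] are the given ones on the [U_i], and therefore agree on the atlas. *)
Lemma open_immersion_is_inclusion (R : realType) (X : aff R) (U : open_immersion X) :
  exists (A : set 'rV[R]_(aff_dim X)) (oA : open A) (AX : A `<=` X),
    oi_iso U (open_incl oA AX).
Proof.
case: U => F p pS; have [S [c [cC pE]]] := pS.
exists (family_image S), (@family_image_open R X S), (@family_image_sub R X S).
have [f [g [gf fg fE]]] := colimit_iso cC (@union_colimit R X S).
exists f, g; split=> //=; apply: (colimit_unique_map cC).
set k := rep_map _.
have kE i : shom_comp (shom_comp k f) (c (inl i)) = rep_map (fam_map i).
  rewrite -shom_compA fE; apply: sheaf_hom_eq => T t; apply: hom_eq => x.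
  by apply: val_inj; exact: to_imageE.
case=> [i|[i j]]; first by rewrite pE kE.
by rewrite -(leg_comm c (Edge1 i j)) !shom_compA kE pE.
Qed.

(** Values at generalised points, that is on sections over all objects, give the
    same set as values at points, and a factorisation visibly preserves them. *)
Definition oi_image (R : realType) (X : aff R) (U : open_immersion X) : set X :=
  [set x | exists (T : aff R) (t : oi_sheaf U T) (y : T), oi_map U T t y = x].

Lemma oi_image_factors (R : realType) (X : aff R) (V U : open_immersion X) :
  oi_factors V U -> oi_image V `<=` oi_image U.
Proof. by move=> [f fE] x [T [t [y <-]]]; exists T, (f T t), y; rewrite -fE. Qed.

Lemma oi_image_iso (R : realType) (X : aff R) (U V : open_immersion X) :
  oi_iso U V -> oi_image U = oi_image V.
Proof.
suff sub : forall U' V' : open_immersion X,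
    oi_iso U' V' -> oi_image U' `<=` oi_image V'.
  by move=> UV; apply/seteqP; split; apply: sub => //; exact: oi_iso_sym.
by move=> U' V' [f [_ [_ _ fE]]]; apply: oi_image_factors; exists f.
Qed.

Lemma oi_image_incl (R : realType) (X : aff R) (A : set 'rV[R]_(aff_dim X))
    (oA : open A) (AX : A `<=` X) :
  oi_image (open_incl oA AX) = [set x : X | A (val x)].
Proof.
apply/seteqP; split=> [x [T [t [y <-]]]|x Ax] /=; first exact/set_mem/(valP (t y)).
by exists (Aff oA), (hom_id _), (exist _ (val x) (mem_set Ax)); exact: val_inj.
Qed.

Lemma open_incl_factors (R : realType) (X : aff R) (A B : set 'rV[R]_(aff_dim X))
    (oA : open A) (AX : A `<=` X) (oB : open B) (BX : B `<=` X) :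
  A `<=` B -> oi_factors (open_incl oA AX) (open_incl oB BX).
Proof.
move=> AB.
have [g gE] : exists g : hom (Aff oA) (Aff oB), forall a, val (g a) = val a.
  apply: (corestriction (f := inclusion oA AX)) => a.
  exact: AB (set_mem (valP a)).
exists (rep_map g); apply: sheaf_hom_eq => T t; apply: hom_eq => x.
by apply: val_inj; exact: gE.
Qed.

Definition os_image (R : realType) (X : aff R) (u : open_subscheme X) : set X :=
  [set x | exists2 U, u U & oi_image U x].

Lemma os_imageE (R : realType) (X : aff R) (u : open_subscheme X)
    (U : open_immersion X) : u U -> os_image u = oi_image U.
Proof.
move=> uU; rewrite (os_classE uU); apply/seteqP; split=> [x [V UV]|x Ux].
  by rewrite (oi_image_iso UV).
by exists U => //; exact: oi_iso_refl.
Qed.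

Lemma os_image_open_class (R : realType) (X : aff R)
    (A : set 'rV[R]_(aff_dim X)) (oA : open A) (AX : A `<=` X) :
  os_image (open_class oA AX) = [set x : X | A (val x)].
Proof. by rewrite -(oi_image_incl oA AX); apply: os_imageE; exact: oi_iso_refl. Qed.

Lemma open_class_onto (R : realType) (X : aff R) (u : open_subscheme X) :
  exists (A : set 'rV[R]_(aff_dim X)) (oA : open A) (AX : A `<=` X),
    u = open_class oA AX.
Proof.
have [U uE] := os_classP u.
have [A [oA [AX UA]]] := open_immersion_is_inclusion U.
by exists A, oA, AX; apply: os_classE; exact/uE.
Qed.

Lemma os_leP (R : realType) (X : aff R) (u v : open_subscheme X) :
  os_le u v <-> os_image u `<=` os_image v.
Proof.
split=> [[U [V [uU vV UV]]]|].
  by rewrite (os_imageE uU) (os_imageE vV); exact: oi_image_factors.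
have [A [oA [AX ->]]] := open_class_onto u.
have [B [oB [BX ->]]] := open_class_onto v.
rewrite !os_image_open_class => AB.
exists (open_incl oA AX), (open_incl oB BX); split; [exact: oi_iso_refl..|].
apply: open_incl_factors => x Ax.
exact: (AB (exist _ x (mem_set (AX _ Ax)))).
Qed.

Lemma os_image_inj (R : realType) (X : aff R) : injective (@os_image R X).
Proof.
move=> u v; have [A [oA [AX ->]]] := open_class_onto u.
have [B [oB [BX ->]]] := open_class_onto v.
rewrite !os_image_open_class => /seteqP[AB BA].
have {AB BA} E : A = B.
  apply/seteqP; split=> x /[dup] => [/AX Xx|/BX Xx].
    exact: (AB (exist _ x (mem_set Xx))).
  exact: (BA (exist _ x (mem_set Xx))).
rewrite E in oA AX *.
by rewrite (Prop_irrelevance oA oB) (Prop_irrelevance AX BX).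
Qed.

(** * Orders isomorphic to the opens of a space *)

(** An order isomorphism [s] from [P] onto the opens of [T], stated so that only
    [T] is the domain of classical sets: [P] may live in a larger universe. *)
Record presents_opens (T : topologicalType) (P : Type) (le : P -> P -> Prop)
    (s : P -> set T) : Prop := PresentsOpens {
  po_open : forall u, open (s u);
  po_onto : forall O, open O -> exists u, s u = O;
  po_inj : injective s;
  po_le : forall u v, le u v <-> s u `<=` s v }.

Lemma presents_union (T : topologicalType) (P : Type) (le : P -> P -> Prop)
    (s : P -> set T) (A : P -> Prop) : presents_opens le s ->
  exists u, s u = [set x | exists2 a, A a & s a x].
Proof.
move=> sP; apply: (po_onto sP); rewrite openE => x [a Aa ax].
apply: (@filterS _ _ _ (s a)) => [y ay|]; first by exists a.
by apply: open_nbhs_nbhs; split=> //; exact: po_open sP a.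
Qed.

Lemma presents_inter (T : topologicalType) (P : Type) (le : P -> P -> Prop)
    (s : P -> set T) (a b : P) : presents_opens le s ->
  exists m, s m = s a `&` s b.
Proof. by move=> sP; apply: (po_onto sP); apply: openI; exact: po_open sP _. Qed.

Lemma presents_sup (T : topologicalType) (P : Type) (le : P -> P -> Prop)
    (s : P -> set T) (A : P -> Prop) (u : P) : presents_opens le s ->
  is_sup le A u <-> s u = [set x | exists2 a, A a & s a x].
Proof.
move=> sP; have [w wE] := presents_union A sP; split=> [[uA Au]|uE].
  apply/seteqP; split=> [|x [a /uA /(po_le sP) au ax]]; last exact: au.
  rewrite -wE; apply/(po_le sP)/Au => a Aa; apply/(po_le sP).
  by rewrite wE => x; exists a.
split=> [a Aa|b bA]; apply/(po_le sP); rewrite uE => x; first by exists a.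
by move=> [a /bA /(po_le sP)]; exact.
Qed.

Lemma presents_meet (T : topologicalType) (P : Type) (le : P -> P -> Prop)
    (s : P -> set T) (a b m : P) : presents_opens le s ->
  is_meet le a b m <-> s m = s a `&` s b.
Proof.
move=> sP; have [w wE] := presents_inter a b sP; split=> [[mab abm]|mE].
  apply/seteqP; split.
    move=> x mx; split.
      by have /(po_le sP) := mab a (or_introl erefl); exact.
    by have /(po_le sP) := mab b (or_intror erefl); exact.
  rewrite -wE; apply/(po_le sP)/abm => y yE; apply/(po_le sP).
  by rewrite wE; case: yE => ->; [exact: subIsetl|exact: subIsetr].
split=> [y [->|->]|c cab]; apply/(po_le sP); rewrite mE.
- exact: subIsetl.
- exact: subIsetr.
by rewrite subsetI; split; apply/(po_le sP)/cab; [left|right].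
Qed.

Lemma presents_locale (T : topologicalType) (P : Type) (le : P -> P -> Prop)
    (s : P -> set T) : presents_opens le s -> is_locale le.
Proof.
move=> sP.
have sup A : exists u, is_sup le A u.
  by have [u uE] := presents_union A sP; exists u; exact/(presents_sup _ _ sP).
split=> //.
- by move=> a; exact/(po_le sP).
- move=> a b c /(po_le sP) ab /(po_le sP) bc; apply/(po_le sP).
  exact: subset_trans bc.
- move=> a b /(po_le sP) ab /(po_le sP) ba.
  by apply: (po_inj sP); apply/seteqP.
(* An infimum is the supremum of the lower bounds. *)
- move=> A; have [u [uA Au]] := sup (fun b => forall a, A a -> le b a).
  exists u; split=> [a Aa|b bA]; last exact: uA.
  by apply: Au => b; exact.
move=> a A u m /(presents_sup _ _ sP) uE /(presents_meet _ _ _ sP) mE.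
apply/(presents_sup _ _ sP); rewrite mE uE; apply/seteqP; split=> x.
  move=> [ax [b Ab bx]].
  have [c cE] := presents_inter a b sP.
  by exists c; [exists b => //; exact/(presents_meet _ _ _ sP)|rewrite cE].
move=> [c [b Ab /(presents_meet _ _ _ sP) cE]]; rewrite cE => -[ax bx].
by split=> //; exists b.
Qed.

(** * Points of the Stone dual *)

Lemma locale_hom_eq (L M : locale) (f g : locale_hom L M) : f =1 g -> f = g.
Proof.
case: f g => [f f0 f1 fs fm] [g g0 g1 gs gm] /= /funext fg.
move: f0 f1 fs fm; rewrite fg => f0 f1 fs fm.
by congr LocaleHom; exact: Prop_irrelevance.
Qed.

Lemma point_exists (T : topologicalType) (P : Type) (le : P -> P -> Prop)
    (s : P -> set T) (sP : presents_opens le s) (H : is_locale le) (x : T) :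
  exists f : stone (Locale H), forall u, f u = `[< s u x >].
Proof.
have f0 (z : Locale H) :
    (forall a, loc_le z a) -> forall b : loc1, @loc_le loc1 `[< s z x >] b.
  move=> z0 b; have [w wE] := po_onto sP open0.
  by have /(po_le sP) := z0 w; rewrite wE => zw; case: asboolP => [/zw|].
have f1 (z : Locale H) :
    (forall a, loc_le a z) -> forall b : loc1, @loc_le loc1 b `[< s z x >].
  move=> z1 b; have [w wE] := po_onto sP openT.
  have /(po_le sP) := z1 w; rewrite wE => zw; apply/implyP => _; apply/asboolP.
  exact: zw.
have fs (A : Locale H -> Prop) (u : Locale H) : is_sup (@loc_le _) A u ->
    is_sup (@loc_le loc1) (fun y => exists2 a, A a & y = `[< s a x >]) `[< s u x >].
  move=> /(presents_sup _ _ sP) uE.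
  split=> [y [a Aa ->]|b bA]; apply/implyP => /asboolP.
    by move=> ax; apply/asboolP; rewrite uE; exists a.
  rewrite uE => -[a Aa ax]; apply: (implyP (bA `[< s a x >] _)).
    by exists a.
  exact/asboolP.
have fm (a b m : Locale H) : is_meet (@loc_le _) a b m ->
    is_meet (@loc_le loc1) `[< s a x >] `[< s b x >] `[< s m x >].
  move=> /(presents_meet _ _ _ sP) mE; split=> [y|c cab]; rewrite mE asbool_and.
    by case=> ->; apply/implyP => /andP[].
  apply/implyP => cT; apply/andP.
  split; first exact: (implyP (cab _ (or_introl erefl))).
  exact: (implyP (cab _ (or_intror erefl))).
by exists (LocaleHom f0 f1 fs fm).
Qed.

(** Sobriety of Hausdorff spaces: the point is the only one outside the largest
    open set that [f] sends to 0. *)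
Lemma stone_point (T : topologicalType) (P : Type) (le : P -> P -> Prop)
    (s : P -> set T) (sP : presents_opens le s) (H : is_locale le)
    (f : stone (Locale H)) : hausdorff_space T ->
  exists x, forall u, f u = `[< s u x >].
Proof.
move=> hT.
pose A (a : Locale H) := f a = false.
have [w w_sup] := loc_sup H A.
have wE := (presents_sup A w sP).1 w_sup.
have fw : f w = false.
  have [_ /(_ false)] := lh_sup f w_sup.
  rewrite /= implybF => fw; apply/negbTE/fw => y [a fa ->].
  by rewrite fa.
(* If [s u] is inside [s w], then [f] preserves the meet [u = u /\ w]. *)
have fwP u : f u = false <-> s u `<=` s w.
  split=> [fu|uw]; first by rewrite wE => x ux; exists u.
  have [+ _] := lh_meet f ((presents_meet u w u sP).2 (esym (setIidl uw))).
  by move=> /(_ (f w) (or_intror erefl)); rewrite fw /= implybF => /negbTE.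
have [x wx] : exists x, ~ s w x.
  apply/existsNP => sw.
  have w1 (a : Locale H) : loc_le a w by apply/(po_le sP) => x _; exact: sw.
  by have := lh_top f w1 true; rewrite fw.
have w_only y : ~ s w y -> y = x.
  move=> wy; case: (eqVneq y x) => // yx; exfalso.
  move: hT; rewrite open_hausdorff => /(_ _ _ yx).
  move=> [[B C] /= [yB xC] [oB oC /eqP BC]].
  have [b bE] := po_onto sP oB; have [c cE] := po_onto sP oC.
  have [z zE] := po_onto sP open0.
  have fz : f z = false by apply/fwP; rewrite zE.
  have fb : f b = true.
    case E: (f b) => //; move/fwP: E => bw.
    by case: wy; apply: bw; rewrite bE; exact/set_mem.
  have fc : f c = true.
    case E: (f c) => //; move/fwP: E => cw.
    by case: wx; apply: cw; rewrite cE; exact/set_mem.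
  have bcz : is_meet le b c z.
    by apply/(presents_meet _ _ _ sP); rewrite zE bE cE.
  have [_ fbc] := lh_meet f bcz.
  suff : @loc_le loc1 true (f z) by rewrite fz.
  by apply: fbc => d [->|->]; rewrite ?fb ?fc.
exists x => u; case: asboolP => ux; last first.
  by apply/fwP => y uy; apply: contrapT => /w_only yx; apply: ux; rewrite -yx.
by case E: (f u) => //; move/fwP: E => uw; case: wx; exact: uw.
Qed.

Lemma stone_homeomorphism_points (T : topologicalType) (P : Type)
    (le : P -> P -> Prop) (s : P -> set T) (sP : presents_opens le s)
    (H : is_locale le) : hausdorff_space T ->
  exists2 phi : T -> stone (Locale H), stone_homeomorphism phi &
    forall x u, phi x u = `[< s u x >].
Proof.
move=> hT; have [phi phiE] := choice (point_exists sP H).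
exists phi => //.
have [psi psiE] := choice (fun f => stone_point sP f hT).
have psiK : cancel psi phi.
  by move=> f; apply: locale_hom_eq => u; rewrite phiE psiE.
have phiI : injective phi.
  move=> x y xy; case: (eqVneq x y) => // nxy; exfalso.
  move: hT; rewrite open_hausdorff => /(_ _ _ nxy).
  move=> [[B C] /= [xB yC] [oB _ /eqP BC]].
  have [b bE] := po_onto sP oB.
  have : phi x b by rewrite phiE bE; apply/asboolP/set_mem.
  rewrite xy phiE bE => /asboolP yB.
  by have : set0 y by rewrite -BC; split=> //; exact/set_mem.
exists psi; split=> //.
- by move=> x; apply: phiI; rewrite psiK.
- move=> O [u uE]; rewrite (_ : [set x | O (phi x)] = s u).
    exact: po_open sP u.
  apply/seteqP; split=> x /=; first by move=> /uE; rewrite phiE => /asboolP.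
  by move=> ux; apply/uE; rewrite phiE; exact/asboolP.
- move=> B oB; have [u uE] := po_onto sP oB; exists u => f.
  by rewrite psiE uE; split=> /asboolP.
Qed.

(** * The locale of open subschemes *)

Lemma set_type_hausdorff (T : topologicalType) (A : set T) :
  hausdorff_space T -> hausdorff_space A.
Proof.
rewrite !open_hausdorff => hT x y xy.
have /hT [[B C] /= [xB yC] [oB oC /eqP BC]] : val x != val y.
  by apply: contra xy => /eqP/val_inj ->.
exists (val @^-1` B, val @^-1` C); split => /=.
- by apply/mem_set; exact: set_mem xB.
- by apply/mem_set; exact: set_mem yC.
- by exists B.
- by exists C.
by rewrite -preimage_setI BC preimage_set0.
Qed.

(** An open subset of [X] is the trace of some open [B] of the ambient space, and
    [X `&` B] is open there because [X] is. *)
Lemma os_image_presents (R : realType) (X : aff R) :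
  presents_opens (@os_le R X) (@os_image R X).
Proof.
split=> [u|O [B oB <-]||u v]; last 2 first.
- exact: os_image_inj.
- exact: os_leP.
- have [A [oA [AX ->]]] := open_class_onto u.
  by rewrite os_image_open_class; exists A.
exists (open_class (openI (aff_open (a := X)) oB) (@subIsetl _ _ _)).
rewrite os_image_open_class; apply/seteqP; split=> x /=; first by case.
by split=> //; exact/set_mem/valP.
Qed.

Lemma os_image_point_complement (R : realType) (X : aff R) (x : X) :
  os_image (point_complement x) = [set~ x].
Proof.
rewrite os_image_open_class; apply/seteqP; split=> [y [_ yx] xy|y yx].
  by apply: yx; rewrite xy.
by split; [exact/set_mem/valP|move=> /val_inj].
Qed.

Lemma le_point_complement (R : realType) (X : aff R) (x : X)
    (u : open_subscheme X) :
  os_le u (point_complement x) <-> ~ os_image u x.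
Proof.
rewrite os_leP os_image_point_complement; split=> [ux /ux|ux y uy yx]; first exact.
by apply: ux; rewrite -yx.
Qed.

Theorem mainTheorem3 (R : realType) (X : aff R) :
  exists H : is_locale (@os_le R X),
  let L := Locale H in
  exists phi : X -> stone L,
  [/\ stone_homeomorphism phi,
      forall x : X,
        let w : L := point_complement x in
        prime_ideal (principal_ideal w) /\
        forall f : stone L, f = phi x <->
          (forall u : L, f u = false <-> principal_ideal w u)
    & forall (A : set 'rV[R]_(aff_dim X)) (oA : open A) (AX : A `<=` X),
        let u : L := open_class oA AX in
        forall f : stone L, f u = true <-> exists2 x : X, A (val x) & f = phi x].
Proof.
pose sP := @os_image_presents R X; pose H := presents_locale sP; exists H => L.
have hX : hausdorff_space X by apply: set_type_hausdorff; exact: norm_hausdorff.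
have [phi phi_homeo phiE] := stone_homeomorphism_points sP H hX.
exists phi; split=> // [x w|A oA AX u f].
  split.
    split=> [|a b m].
      have [v vE] := po_onto sP openT; exists v => /le_point_complement; apply.
      by rewrite vE.
    move=> na nb /(presents_meet _ _ _ sP) mE /le_point_complement; apply.
    by rewrite mE; split; apply: contrapT => /le_point_complement.
  move=> f; split=> [-> u|fE].
    rewrite phiE; split=> [/asboolPn/le_point_complement //|].
    by move=> /le_point_complement/asboolPn/negbTE.
  apply: locale_hom_eq => u; rewrite phiE; case: asboolP => [ux|].
    by case E: (f u) => //; move/fE: E => /le_point_complement.
  by move=> /le_point_complement/fE.
have [psi [_ psiK _ _]] := phi_homeo.
have uE : os_image u = [set x : X | A (val x)] by exact: os_image_open_class.
split=> [fu|[x Ax ->]]; last by rewrite phiE uE; exact/asboolP.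
by exists (psi f) => //; move: fu; rewrite -{1}(psiK f) phiE uE => /asboolP.
Qed.
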